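(* There is an unweighted $\epsilon$-approximate spherical $2t$-design in $\mathbb{R}^d$ with at most $O_t(\epsilon^{-2}d^{2t})$ points.
   Context: Let $\mu$ be the Lebesgue measure on the unit sphere $S^{d-1}\subset\mathbb{R}^d$, normalized so that $\mu(S^{d-1})=1$, and let $\|f\|_2=\left(\int_{S^{d-1}}|f|^2\,d\mu\right)^{1/2}$. A finite set $X\subset S^{d-1}$ is an (unweighted) $\epsilon$-approximate spherical $s$-design in $\mathbb{R}^d$ if $\left|\frac{1}{|X|}\sum_{x\in X}f(x)-\int_{S^{d-1}}f\,d\mu\right|\le\epsilon\|f\|_2$ for every polynomial $f$ of degree at most $s$. The notation $O_t(\cdot)$ means that the implied constant depends only on $t$.
   Formalization: The bound is read as max(1, C_t ε^{-2} d^{2t}), for all ε > 0 and d ≥ 1: a design has at least one point, so for ε much larger than d^t the bound O_t(ε^{-2} d^{2t}) falls below 1 and cannot hold; for ε ≤ d^t it is the bound as stated. *)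

(* Defs.v *)
From HB Require Import structures.
From mathcomp Require Import all_boot all_order all_algebra finmap.
From mathcomp Require Import -(notations) mpoly.
From mathcomp Require Import all_classical all_reals all_analysis.
From mathcomp Require Import measurable_realfun.

Set Implicit Arguments.
Unset Strict Implicit.
Unset Printing Implicit Defensive.
Import Order.TTheory GRing.Theory Num.Theory.
Import numFieldNormedType.Exports.

Local Open Scope fset_scope.
Local Open Scope classical_set_scope.
Local Open Scope ring_scope.

Section euclidean.
Context {R : realType}.

Definition norm2 d (x : d.-tuple R) : R :=
  Num.sqrt (\sum_(i < d) tnth x i ^+ 2).

Definition unit_ball d : set (d.-tuple R) := [set x | norm2 x <= 1].

Definition unit_sphere d : set (d.-tuple R) := [set x | norm2 x = 1].

(* x |-> x / |x|; the origin is sent to itself since a / 0 = 0. *)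
Definition radial_proj d (x : d.-tuple R) : d.-tuple R :=
  [tuple tnth x i / norm2 x | i < d].

Lemma measurable_norm2 d : measurable_fun [set: d.-tuple R] (@norm2 d).
Proof.
apply: (@measurableT_comp _ _ _ _ _ _ (@Num.sqrt R)).
  by apply: continuous_measurable_fun; exact: sqrt_continuous.
by apply: measurable_sum => i; apply: measurable_funX; exact: measurable_tnth.
Qed.

Lemma measurable_unit_ball d : measurable (@unit_ball d).
Proof.
rewrite -[X in measurable X]setTI.
have -> : @unit_ball d = @norm2 d @^-1` `]-oo, 1%R].
  by apply/seteqP; split=> x /=; rewrite in_itv.
by apply: measurable_norm2.
Qed.

Lemma measurable_unit_sphere d : measurable (@unit_sphere d).
Proof.
rewrite -[X in measurable X]setTI.
by apply: (@measurable_norm2 d _ [set 1%R]).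
Qed.

Lemma measurable_invr : measurable_fun [set: R] (@GRing.inv R).
Proof.
rewrite -(setUv [set 0 : R]); apply/measurable_funU => //.
  exact: measurableC.
split; first exact: measurable_fun_set1.
apply: open_continuous_measurable_fun.
  by apply: closed_openC; exact: closed_eq.
by move=> x; rewrite inE /= => /eqP x0; exact: inv_continuous.
Qed.

Lemma measurable_radial_proj d :
  measurable_fun [set: d.-tuple R] (@radial_proj d).
Proof.
apply/measurable_fun_tnthP => i.
rewrite (_ : _ \o _ = fun x => tnth x i * (norm2 x)^-1); last first.
  by apply/funext => x /=; rewrite tnth_mktuple.
apply: measurable_funM; first exact: measurable_tnth.
exact: (measurableT_comp measurable_invr (@measurable_norm2 d)).
Qed.

Lemma norm2_radial_proj d (x : d.-tuple R) :
  norm2 x != 0 -> norm2 (radial_proj x) = 1.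
Proof.
move=> x0; rewrite {1}/norm2.
under eq_bigr do rewrite tnth_mktuple expr_div_n.
rewrite -mulr_suml sqrtrM; last by apply: sumr_ge0 => i _; exact: sqr_ge0.
by rewrite sqrtrV ?sqr_ge0// sqrtr_sqr ger0_norm ?sqrtr_ge0// divff.
Qed.

End euclidean.

Section sigma_finite_measure_of.
Context {R : realType} d (T : measurableType d) (m : {measure set T -> \bar R}).
Hypothesis sf : sigma_finite setT m.

Let mu : set T -> \bar R := m.

HB.instance Definition _ := Measure.on mu.
HB.instance Definition _ := Measure_isSigmaFinite.Build _ _ _ mu sf.

Definition sigma_finite_measure_of : {sigma_finite_measure set T -> \bar R} :=
  mu.

End sigma_finite_measure_of.

Section lebesgue_tuple.
Context {R : realType}.
Local Open Scope ereal_scope.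

Definition cons_pair d (p : R * d.-tuple R) : d.+1.-tuple R :=
  [tuple of p.1 :: p.2].

Lemma measurable_cons_pair d :
  measurable_fun [set: R * d.-tuple R] (@cons_pair d).
Proof. exact: measurable_cons. Qed.

Fixpoint lebesgue_tuple d : set (d.-tuple R) -> \bar R :=
  if d is d'.+1
  then pushforward (@lebesgue_measure R \x @lebesgue_tuple d') (@cons_pair d')
  else \d_[tuple].

Let uncons d (x : d.+1.-tuple R) : R * d.-tuple R :=
  (thead x, [tuple of behead x]).

Let measurable_uncons d : measurable_fun [set: d.+1.-tuple R] (@uncons d).
Proof.
apply: measurable_fun_pair; [exact: measurable_tnth|exact: measurable_behead].
Qed.

Let cons_pairK d : cancel (@cons_pair d) (@uncons d).
Proof.
case=> a x; rewrite /uncons /cons_pair /= theadE; congr pair.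
exact/val_inj.
Qed.

Lemma lebesgue_tuple_sigma_finite_measure d :
  exists mu : {sigma_finite_measure set (d.-tuple R) -> \bar R},
    lebesgue_tuple (d := d) = mu.
Proof.
elim: d => [|d [mu muE]].
  by exists \d_[tuple]; apply/funext.
pose leb : {sigma_finite_measure set (measurableTypeR R) -> \bar R} :=
  @lebesgue_measure R.
pose m : {measure set (d.+1.-tuple R) -> \bar R} :=
  measure_function_pushforward__canonical__measure_function_Measure
    (leb \x mu) (measurable_cons_pair (d := d)).
have sf : sigma_finite setT m.
  have /sigma_finiteP[F [TF ndF Foo]] := sigma_finiteT leb.
  have /sigma_finiteP[G [TG ndG Goo]] := sigma_finiteT mu.
  exists (fun k => @uncons d @^-1` (F k `*` G k)).
    rewrite -preimage_bigcup (_ : \bigcup_i _ = setT) ?preimage_setT//.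
    apply/seteqP; split=> // -[x y] _.
    have [i _ Fx] : (\bigcup_k F k) x by rewrite -TF.
    have [j _ Gy] : (\bigcup_k G k) y by rewrite -TG.
    exists (maxn i j) => //; split => /=.
      by move: x Fx; exact/subsetPset/ndF/leq_maxl.
    by move: y Gy; exact/subsetPset/ndG/leq_maxr.
  move=> k; have [mF Fk] := Foo k; have [mG Gk] := Goo k; split.
    rewrite -[X in measurable X]setTI; apply: measurable_uncons => //.
    exact: measurableX.
  rewrite /m /= /pushforward (_ : _ @^-1` _ = F k `*` G k); last first.
    by apply/funext => p; rewrite /preimage /mkset cons_pairK.
  by rewrite product_measure1E// lte_mul_pinfty// ge0_fin_numE.
exists (sigma_finite_measure_of sf).
by rewrite /= muE.
Qed.

Let lebesgue_tuple0 d : lebesgue_tuple (@set0 (d.-tuple R)) = 0.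
Proof.
by have [mu ->] := lebesgue_tuple_sigma_finite_measure d; exact: measure0.
Qed.

Let lebesgue_tuple_ge0 d (A : set (d.-tuple R)) : 0 <= lebesgue_tuple A.
Proof.
by have [mu ->] := lebesgue_tuple_sigma_finite_measure d; exact: measure_ge0.
Qed.

Let lebesgue_tuple_sigma_additive d :
  semi_sigma_additive (@lebesgue_tuple d).
Proof.
have [mu ->] := lebesgue_tuple_sigma_finite_measure d.
exact: measure_semi_sigma_additive.
Qed.

HB.instance Definition _ d := isMeasure.Build _ _ _ (@lebesgue_tuple d)
  (@lebesgue_tuple0 d) (@lebesgue_tuple_ge0 d)
  (@lebesgue_tuple_sigma_additive d).

Let lebesgue_tuple_sigma_finite d : sigma_finite setT (@lebesgue_tuple d).
Proof.
have [mu ->] := lebesgue_tuple_sigma_finite_measure d.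
exact: sigma_finiteT.
Qed.

HB.instance Definition _ d := Measure_isSigmaFinite.Build _ _ _
  (@lebesgue_tuple d) (@lebesgue_tuple_sigma_finite d).

Definition cube d (I : set R) : set (d.-tuple R) :=
  [set x | forall i, I (tnth x i)].
Arguments cube : clear implicits.

Lemma measurable_cube d (I : set R) : measurable I -> measurable (cube d I).
Proof.
move=> mI.
rewrite (_ : cube d I = \bigcap_(i in [set: 'I_d]) (@tnth d R ^~ i @^-1` I)).
  apply: fin_bigcap_measurable; first exact: finite_finset.
  move=> i _; rewrite -[X in measurable X]setTI.
  exact: measurable_tnth.
by apply/seteqP; split => [x Ix i _|x Ix i] /=; exact: Ix.
Qed.

Lemma lebesgue_tuple_cube d (I : set R) : measurable I ->
  lebesgue_tuple (cube d I) = lebesgue_measure I ^+ d.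
Proof.
move=> mI; elim: d => [|d ih].
  by rewrite /= diracE mem_set// => -[].
rewrite [LHS]/= /pushforward.
rewrite (_ : _ @^-1` _ = I `*` cube d I); last first.
  apply/seteqP; split => -[a x] /=.
    move=> h; split; first by have := h ord0; rewrite (tnth_nth a).
    move=> i; have := h (lift ord0 i).
    by rewrite !(tnth_nth a).
  move=> [Ia Ix] i; rewrite /cons_pair /=.
  case: (unliftP ord0 i) => [j ->|->]; last by rewrite (tnth_nth a).
  by have := Ix j; rewrite !(tnth_nth a).
rewrite product_measure1E//; last exact: measurable_cube.
by rewrite expeS; congr (_ * _); exact: ih.
Qed.

End lebesgue_tuple.
Arguments cube {R} d I.

Section sphere_measure.
Context {R : realType}.
Local Open Scope ereal_scope.

Lemma lebesgue_unit_ball_gt0 d : 0 < lebesgue_tuple (@unit_ball R d).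
Proof.
pose I : set R := `[0%R, (d.+1%:R^-1)%R]%classic.
have mI : measurable I by exact: measurable_itv.
have I0 : 0 < lebesgue_tuple (cube d I).
  rewrite lebesgue_tuple_cube// lebesgue_measure_itv/= lte_fin invr_gt0 ltr0n/=.
  by rewrite oppr0 adde0 -EFin_expe lte_fin exprn_gt0// invr_gt0 ltr0n.
apply: (lt_le_trans I0); apply: le_measure; rewrite ?inE.
- exact: measurable_cube.
- exact: measurable_unit_ball.
- move=> x Ix; rewrite /unit_ball /= /norm2 -[leRHS]sqrtr1 ler_wsqrtr//.
  apply: (@le_trans _ _ (\sum_(i < d) d.+1%:R^-1)%R).
    apply: ler_sum => i _; have := Ix i.
    rewrite /I /= in_itv /= => /andP[x0 x1].
    rewrite expr2 -[leRHS]mulr1 ler_pM// (le_trans x1)// invf_le1 ?ltr0n//.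
    by rewrite ler1n.
  rewrite sumr_const card_ord -[leLHS]mulr_natr mulrC ler_pdivrMr ?ltr0n//.
  by rewrite mul1r ler_nat.
Qed.

Lemma lebesgue_unit_ball_lty d : lebesgue_tuple (@unit_ball R d) < +oo.
Proof.
pose I : set R := `[(-1)%R, 1%R]%classic.
have mI : measurable I by exact: measurable_itv.
apply: (@le_lt_trans _ _ (lebesgue_tuple (cube d I))).
  apply: le_measure; rewrite ?inE.
  - exact: measurable_unit_ball.
  - exact: measurable_cube.
  - move=> x; rewrite /unit_ball /= /norm2 => x1 i.
    rewrite /I /= in_itv /= -ler_norml -sqrtr_sqr (le_trans _ x1)//.
    rewrite ler_wsqrtr// (bigD1 i)//= lerDl sumr_ge0// => j _.
    exact: sqr_ge0.
rewrite lebesgue_tuple_cube// lebesgue_measure_itv/= lte_fin gtrN//.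
by rewrite -EFinB -EFin_expe ltry.
Qed.

(* The cone measure, i.e., the image under x |-> x / |x| of the uniform
   probability on the unit ball. It is a measure on the whole space, carried by
   the sphere. *)
Definition sphere_measure d (A : set (d.-tuple R)) : \bar R :=
  ((fine (lebesgue_tuple (@unit_ball R d)))^-1)%:E *
  lebesgue_tuple (@radial_proj R d @^-1` A `&` @unit_ball R d).

Let volV_ge0 d : (0 <= (fine (lebesgue_tuple (@unit_ball R d)))^-1)%R.
Proof. by rewrite invr_ge0 fine_ge0// ltW// lebesgue_unit_ball_gt0. Qed.

Let sphere_mscale d : {measure set (d.-tuple R) -> \bar R} :=
  mscale (NngNum (volV_ge0 d))
    (measure_function_pushforward__canonical__measure_function_Measure
      (mrestr (@lebesgue_tuple R d) (@measurable_unit_ball R d))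
      (@measurable_radial_proj R d)).

Let sphere_measure0 d : sphere_measure (@set0 (d.-tuple R)) = 0.
Proof. exact: (measure0 (sphere_mscale d)). Qed.

Let sphere_measure_ge0 d (A : set (d.-tuple R)) : 0 <= sphere_measure A.
Proof. exact: (measure_ge0 (sphere_mscale d)). Qed.

Let sphere_measure_sigma_additive d : semi_sigma_additive (@sphere_measure d).
Proof. exact: (@measure_semi_sigma_additive _ _ _ (sphere_mscale d)). Qed.

HB.instance Definition _ d := isMeasure.Build _ _ _ (@sphere_measure d)
  (@sphere_measure0 d) (@sphere_measure_ge0 d)
  (@sphere_measure_sigma_additive d).

Lemma sphere_measureT d : sphere_measure [set: d.-tuple R] = 1.
Proof.
rewrite /sphere_measure preimage_setT setTI.
have B0 := lebesgue_unit_ball_gt0 d; have Boo := lebesgue_unit_ball_lty d.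
rewrite -[X in _ * X]fineK ?ge0_fin_numE ?(ltW B0)//.
by rewrite -EFinM mulVf// gt_eqF// fine_gt0// B0.
Qed.

HB.instance Definition _ d := Measure_isProbability.Build _ _ _
  (@sphere_measure d) (@sphere_measureT d).

Lemma sphere_measure_sphere d : (0 < d)%N ->
  sphere_measure (@unit_sphere R d) = 1.
Proof.
move=> d0.
suff : sphere_measure (~` @unit_sphere R d) = 0.
  move=> S0; rewrite -(sphere_measureT d) -(setUv (@unit_sphere R d)).
  have mS := @measurable_unit_sphere R d.
  rewrite measureU//; last by rewrite setICr.
    by rewrite [X in _ = _ + X]S0 adde0.
  exact: measurableC.
rewrite /sphere_measure (_ : lebesgue_tuple (_ `&` _) = 0) ?mule0//.
have m0 : measurable [set 0%R : R] by [].
have C0 : lebesgue_tuple (cube d [set 0%R : R]) = 0.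
  rewrite lebesgue_tuple_cube// lebesgue_measure_set1.
  by case: d d0 => // d _; rewrite expeS mul0e.
apply/le_anti/andP; split; last exact: measure_ge0.
rewrite -[leRHS]C0.
apply: le_measure; rewrite ?inE.
- apply: measurableI; last exact: measurable_unit_ball.
  rewrite -[X in measurable X]setTI; apply: measurable_radial_proj => //.
  by apply: measurableC; exact: measurable_unit_sphere.
- exact: measurable_cube.
- move=> x [/= nS _] i /=.
  have [/eqP|x0] := eqVneq (norm2 x) 0%R; last first.
    by exfalso; apply: nS; exact: norm2_radial_proj.
  rewrite sqrtr_eq0 => le0.
  have : (\sum_(i < d) tnth x i ^+ 2 == 0)%R.
    by rewrite eq_le le0 sumr_ge0// => j _; exact: sqr_ge0.
  rewrite psumr_eq0; last by move=> j _; exact: sqr_ge0.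
  by move=> /allP/(_ i); rewrite mem_index_enum sqrf_eq0 => /(_ isT)/eqP.
Qed.

End sphere_measure.

Section approximate_design.
Context {R : realType}.

Definition peval d (p : mpoly d R) (x : d.-tuple R) : R :=
  meval (tnth x) p.

(* mmeasure mdeg p is 1 + the total degree of p, and 0 for p = 0. *)
Definition deg_le d (s : nat) (p : mpoly d R) : Prop :=
  (mmeasure mdeg p <= s.+1)%N.

Definition sphere_mean d (f : d.-tuple R -> R) : R :=
  \int[@sphere_measure R d]_(x in unit_sphere (d := d)) f x.

Definition sphere_norm2 d (f : d.-tuple R -> R) : R :=
  Num.sqrt (sphere_mean (fun x => `|f x| ^+ 2)).

(* Unweighted: X is a set, and all its points have the same weight 1 / |X|,
   which only makes sense for a nonempty X. *)
Definition approx_design d (s : nat) (eps : R) (X : {fset d.-tuple R}) : Prop :=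
  [/\ X != fset0,
      forall x, x \in X -> unit_sphere x &
      forall p : mpoly d R, deg_le s p ->
        `| (\sum_(x <- X) peval p x) / #|` X|%:R - sphere_mean (peval p) |
          <= eps * sphere_norm2 (peval p)].

End approximate_design.

(* Main.v *)
Require Import Defs.
From HB Require Import structures.
From mathcomp Require Import all_boot all_order all_algebra finmap.
From mathcomp Require Import -(notations) mpoly.
From mathcomp Require Import all_classical all_reals all_analysis.
From mathcomp Require Import measurable_realfun ring lra.

Set Implicit Arguments.
Unset Strict Implicit.
Unset Printing Implicit Defensive.
Import Order.TTheory GRing.Theory Num.Theory.

Local Open Scope fset_scope.
Local Open Scope ring_scope.

(** Write [L p] for the mean of the polynomial [p] over the sphere and
[<p, q> = L (p q)]. Sampling [n] independent uniform points gives an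
approximate design: if [psi_1, ..., psi_N] is an orthonormal basis of the space
of polynomials of degree at most [s] on the sphere, then by Cauchy-Schwarz the
squared error on a polynomial of norm [1] is at most
[sum_j ((1/n) sum_x (psi_j x - L psi_j))^2], whose expectation is at most
[N / n]. As [N <= (d + 1)^s <= (2 d)^s], the error is at most [eps] as soon as
[n >= (2 d)^s / eps^2].

The proof below derandomizes this. The points are chosen one after the other
([exists_balanced_points]): averaging over the next point, there is always a
choice that increases [sum_j (sum_x (psi_j x - L psi_j))^2] by at most [N]. This
needs one-point averages only, hence no product of copies of the sphere, and it
lets each point avoid any prescribed null set ([exists_le_mean]). Null sets serve
twice. Distinctness of the points: for [d >= 2] the sphere measure has no atoms
([sphere_measure_set1]), so the earlier points may be excluded. Degeneracy of
[<_, _>] on polynomials, some of which, such as [|x|^2 - 1], vanish on the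
sphere: the Gram-Schmidt procedure ([exists_parseval_frame]) expresses the
monomials through the [psi_j] up to finitely many polynomials of norm [0], and
the points are taken among the common zeros of these, almost all points of the
sphere.

In dimension [1] the sphere is [{1, -1}], of mass [1/2] each. Both points
together form an exact design, and a single point suffices when [eps >= 1]. *)

(** * Gram-Schmidt for a positive semidefinite form *)

Section parseval_frame.
Context {R : realType} {V : lmodType R} (B : V -> V -> R).
Hypothesis B_linear : forall a u v w, B (a *: u + v) w = a * B u w + B v w.
Hypothesis B_sym : forall u v, B u v = B v u.
Hypothesis B_ge0 : forall u, 0 <= B u u.

Let BD u v w : B (u + v) w = B u w + B v w.
Proof. by rewrite -[u]scale1r B_linear mul1r scale1r. Qed.

Let B0 w : B 0 w = 0.
Proof. by apply: (addrI (B 0 w)); rewrite -BD !addr0. Qed.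

Let BZ a u w : B (a *: u) w = a * B u w.
Proof. by rewrite -[_ *: _]addr0 B_linear B0 addr0. Qed.

Let BB u v w : B (u - v) w = B u w - B v w.
Proof. by rewrite BD -scaleN1r BZ mulN1r. Qed.

Let Bsum (s : seq V) (c : V -> R) w :
  B (\sum_(g <- s) c g *: g) w = \sum_(g <- s) c g * B g w.
Proof.
by elim/big_ind2: _ => [|x a y b <- <-|g _]; rewrite ?B0 ?BD ?BZ.
Qed.

Definition form_radical u := forall w, B u w = 0.

(** If [B u w] did not vanish, the affine function [a |-> B (a u + w) (a u + w)]
would not be constant, and so would take negative values. *)
Lemma form_radicalP u : B u u = 0 -> form_radical u.
Proof.
move=> Bu w; apply/eqP/negP => /negP Buw.
(* The value of [a] at which that affine function equals [-1]. *)
pose a := - (B w w + 1) / (B u w *+ 2).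
have := B_ge0 (a *: u + w).
rewrite B_linear [B u (_ + _)]B_sym B_linear [B w (_ + _)]B_sym B_linear Bu.
rewrite [B w u]B_sym /a (_ : _ + _ = -1); last by field.
by rewrite ler0N1.
Qed.

Definition residual (s : seq V) f := f - \sum_(g <- s) B f g *: g.

(** If [s] is orthonormal, this is Parseval's identity; orthonormality enters
only through the vanishing of the residual, the form in which
[exists_parseval_frame] provides it. *)
Lemma parseval (s : seq V) f : form_radical (residual s f) ->
  \sum_(g <- s) B f g ^+ 2 = B f f.
Proof.
move=> /(_ f); rewrite /residual BB Bsum => /eqP; rewrite subr_eq0 => /eqP ->.
by apply: eq_bigr => g _; rewrite [B g f]B_sym.
Qed.

(** Gram-Schmidt: a vector of [fs] whose residual [r] has norm [0] is dropped,
and otherwise [r / |r|] is added to the frame. *)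
Lemma exists_parseval_frame (fs : seq V) : exists s : seq V,
  [/\ (size s <= size fs)%N, {in s, forall g, B g g <= 1} &
      {in fs, forall f, form_radical (residual s f)}].
Proof.
(* Orthonormality is carried through the induction as the last clause: the
residual of each member of the frame is in the radical. *)
suff [s [? ? ? _]] : exists s : seq V,
    [/\ (size s <= size fs)%N, {in s, forall g, B g g <= 1},
      {in fs, forall f, form_radical (residual s f)} &
      {in s, forall f, form_radical (residual s f)}] by exists s.
elim: fs => [|f fs [s [ss s1 fsr sr]]]; first by exists [::].
set r := residual s f.
(* Vectors already expanded in [s] are orthogonal to the new direction, so that
adding it leaves their residuals unchanged. *)
have orth g : form_radical (residual s g) -> B g r = 0.
  move=> /(_ f); rewrite /residual BB Bsum => /eqP; rewrite subr_eq0 => /eqP gf.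
  rewrite B_sym /r /residual BB Bsum B_sym gf -sumrB big1// => k _.
  by rewrite [B k f]B_sym [B k g]B_sym mulrC subrr.
have [r0|r0] := eqVneq (B r r) 0.
  exists s; split=> //; first exact: leqW.
  by move=> g /[!inE]/orP[/eqP->|/fsr//]; exact: form_radicalP.
have rpos : 0 < B r r by rewrite lt_neqAle eq_sym r0 B_ge0.
pose c := (Num.sqrt (B r r))^-1.
have c2 : c * c * B r r = 1.
  rewrite -expr2 /c exprVn sqr_sqrtr ?B_ge0//; exact: mulVf.
have residual_cons g : residual (c *: r :: s) g =
    residual s g - (c * B g r * c) *: r.
  rewrite /residual big_cons [B g _]B_sym BZ [B r g]B_sym scalerA.
  by rewrite opprD addrCA [RHS]addrC.
have oldr g : form_radical (residual s g) ->
    form_radical (residual (c *: r :: s) g).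
  by move=> gr; rewrite residual_cons orth// mulr0 mul0r scale0r subr0.
have sr0 : \sum_(g <- s) B r g *: g = 0.
  rewrite big_seq big1// => g gs.
  by rewrite B_sym orth ?scale0r//; exact: sr.
exists (c *: r :: s); split => //.
- move=> g /[!inE]/orP[/eqP->|/s1//].
  by rewrite BZ B_sym BZ mulrA c2.
- move=> g /[!inE]/orP[/eqP->|/fsr]; last exact: oldr.
  have fr : B f r = B r r.
    rewrite [in RHS]/r {1}/residual BB Bsum.
    rewrite [X in _ - X]big_seq big1 ?subr0// => k ks.
    by rewrite orth ?mulr0//; exact: sr.
  rewrite residual_cons fr mulrAC c2 scale1r subrr.
  exact: B0.
- move=> g /[!inE]/orP[/eqP->|/sr]; last exact: oldr.
  rewrite residual_cons BZ mulrA c2 mul1r /residual.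
  under eq_bigr do rewrite BZ -scalerA.
  rewrite -scaler_sumr sr0 scaler0 subr0 subrr.
  exact: B0.
Qed.

Lemma residual_sum (I : Type) (r : seq I) (c : I -> R) (f : I -> V) s :
  residual s (\sum_(i <- r) c i *: f i) = \sum_(i <- r) c i *: residual s (f i).
Proof.
elim/big_rec2: _ => [|i u v _ <-].
  by rewrite /residual big1 ?subr0// => g _; rewrite B0 scale0r.
rewrite /residual; under eq_bigr do rewrite B_linear scalerDl -scalerA.
by rewrite big_split/= -scaler_sumr scalerBr opprD addrACA.
Qed.

Lemma form_radical_sum (I : Type) (r : seq I) (c : I -> R) (f : I -> V) :
  (forall i, form_radical (f i)) -> form_radical (\sum_(i <- r) c i *: f i).
Proof.
move=> fr w; elim/big_rec: _ => [|i u _ u0]; first exact: B0.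
by rewrite B_linear fr u0 mulr0 addr0.
Qed.

End parseval_frame.

(** * Polynomials of bounded degree *)

(** A monomial of degree at most [s] is a word of length [s] in the variables,
padded with [None]; this gives the crude bound [(d + 1)^s] on the number of
such monomials. *)
Lemma multinom_word d s (m : multinom d) : (mdeg m <= s)%N ->
  exists w : s.-tuple (option 'I_d), forall i, m i = count_mem (Some i) w.
Proof.
elim: s m => [|s ih] m.
  rewrite leqn0 mdeg_eq0 => /eqP ->; exists [tuple] => i.
  by rewrite mnm0E.
move=> ms; have [/eqP m0|] := boolP (mdeg m == 0)%N.
  move: (m0) => /eqP; rewrite mdeg_eq0 => /eqP ->.
  exists [tuple of nseq s.+1 None] => i; rewrite mnm0E.
  by apply/esym/eqP; rewrite -leqn0 leqNgt -has_count has_nseq.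
rewrite mdeg_eq0 => m0.
have [i mi] : exists i, (m i != 0)%N.
  apply/existsP; apply: contraNT m0 => /existsPn m0.
  by apply/eqP/mnmP => i; rewrite mnm0E; have /negPn/eqP := m0 i.
have Um : mpoly.lem (mnm1 i) m by rewrite lep1mP.
have [|w wE] := ih (mnm_sub m (mnm1 i)).
  by move: ms; rewrite -{1}(submK Um) mdegD mdeg1 addn1.
exists [tuple of Some i :: w] => j.
rewrite -{1}(submK Um) mnmDE wE mnm1E /= addnC; congr (_ + _)%N.
Qed.

Lemma card_bmultinom_le d s : (#|{: bmultinom d s.+1}| <= d.+1 ^ s)%N.
Proof.
have wordP (m : bmultinom d s.+1) :
  {w : s.-tuple (option 'I_d) | forall i, bmnm m i = count_mem (Some i) w}.
  by apply/cid/multinom_word; have := bmdeg m.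
have -> : (d.+1 ^ s)%N = #|{: s.-tuple (option 'I_d)}|.
  by rewrite card_tuple card_option card_ord.
apply: (@leq_card _ _ (fun m => sval (wordP m))) => m n mn.
apply/val_inj/mnmP => i /=.
by rewrite (svalP (wordP m)) (svalP (wordP n)) mn.
Qed.

Lemma deg_leE (R : realType) d s (p : mpoly d R) : deg_le s p ->
  p = \sum_(m : bmultinom d s.+1) mcoeff m p *: mpolyX R m.
Proof. by move=> /mpolywE. Qed.

(** * The mean over the sphere as a positive functional *)

Lemma measurable_tuple_set1 (R : realType) d (x : d.-tuple R) :
  measurable [set x]%classic.
Proof.
rewrite (_ : [set x]%classic =
    (\bigcap_(i in [set: 'I_d])
      ((@tnth d R ^~ i) @^-1` [set tnth x i]))%classic).
  apply: fin_bigcap_measurable; first exact: finite_finset.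
  by move=> i _; rewrite -[X in measurable X]setTI; exact: measurable_tnth.
apply/seteqP; split=> [_ -> i _//|y xy] /=.
by apply: eq_from_tnth => i; exact: xy.
Qed.

Section polynomials_on_sphere.
Context {R : realType} {d : nat}.
Local Open Scope classical_set_scope.
Local Notation mu := (@sphere_measure R d).
Local Notation S := (@unit_sphere R d).
Local Notation mean p := (sphere_mean (peval p)).
Implicit Types p q h u : mpoly d R.

Lemma measurable_peval p : measurable_fun setT (peval p).
Proof.
apply: measurable_sum => m; apply: measurable_funM => //.
apply: measurable_prod => i _; apply: measurable_funX.
exact: measurable_tnth.
Qed.

Lemma unit_sphere_coord_le1 (x : d.-tuple R) i : S x -> `|tnth x i| <= 1.
Proof.
rewrite /unit_sphere/= => <-; rewrite -sqrtr_sqr ler_wsqrtr// (bigD1 i)//=.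
by rewrite lerDl sumr_ge0// => j _; exact: sqr_ge0.
Qed.

Lemma peval_bounded p (x : d.-tuple R) : S x ->
  `|peval p x| <= \sum_(m <- msupp p) `|mcoeff m p|.
Proof.
move=> Sx; apply: le_trans (ler_norm_sum _ _ _) _.
apply: ler_sum => m _; rewrite normrM ler_piMr// normr_prod.
apply: prodr_ile1 => i _; rewrite normr_ge0 normrX exprn_ile1//.
exact: unit_sphere_coord_le1.
Qed.

Lemma integrable_peval p : mu.-integrable S (EFin \o peval p).
Proof.
apply: measurable_bounded_integrable.
- exact: measurable_unit_sphere.
- rewrite (le_lt_trans (probability_le1 _ _)) ?ltry//.
  exact: measurable_unit_sphere.
- exact: measurable_funTS (measurable_peval p).
- exists (\sum_(m <- msupp p) `|mcoeff m p|); split; first exact: num_real.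
  by move=> M /ltW pM x /(peval_bounded p)/le_trans; exact.
Qed.

Lemma sphere_mean_linear a p q : mean (a *: p + q) = a * mean p + mean q.
Proof.
have mS := @measurable_unit_sphere R d.
rewrite /sphere_mean -RintegralZl//; last exact: integrable_peval.
rewrite -RintegralD//; last 2 first.
- have := integrable_peval (a *: p); congr (_.-integrable _ _).
  by apply/funext => x /=; rewrite /peval mevalZ.
- exact: integrable_peval.
by apply: eq_Rintegral => x _; rewrite /peval mevalD mevalZ.
Qed.

Lemma sphere_mean_sqr_ge0 p : 0 <= mean (p * p).
Proof.
by apply: Rintegral_ge0 => x _; rewrite /peval mevalM -expr2 sqr_ge0.
Qed.

Lemma sphere_norm2E p : sphere_norm2 (peval p) = Num.sqrt (mean (p * p)).
Proof.
congr Num.sqrt; apply: eq_Rintegral => x _.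
by rewrite real_normK ?num_real// /peval mevalM expr2.
Qed.

Hypothesis d_gt0 : (0 < d)%N.

Lemma sphere_mean1 : mean (1 : mpoly d R) = 1.
Proof.
rewrite /sphere_mean (@eq_Rintegral _ _ _ _ _ (cst 1)); last first.
  by move=> x _; rewrite /peval meval1.
rewrite Rintegral_cst; last exact: measurable_unit_sphere.
by rewrite mul1r [X in fine X]sphere_measure_sphere.
Qed.

Lemma ae_unit_sphere : \forall x \ae mu, S x.
Proof.
have mS := @measurable_unit_sphere R d.
apply/(negligibleP mu (measurableC mS)).
have := probability_setC mu mS.
by rewrite [X in (1 - X)%E]sphere_measure_sphere// subee.
Qed.

(** The conclusion holds almost everywhere in the whole space, since the measure
is carried by the sphere. *)
Lemma ae_zero_of_mean0 p : (\forall x \ae mu, S x -> 0 <= peval p x) ->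
  mean p = 0 -> \forall x \ae mu, peval p x = 0.
Proof.
move=> p0 mp0.
have mS := @measurable_unit_sphere R d.
have mp : measurable_fun S (EFin \o peval p).
  exact: measurable_int (integrable_peval p).
have : (\int[mu]_(x in S) `|(EFin \o peval p) x| = 0)%E.
  transitivity (\int[mu]_(x in S) (EFin \o peval p) x)%E; last first.
    rewrite -[LHS]fineK; last exact: integrable_fin_num (integrable_peval p).
    by congr EFin.
  apply: ae_eq_integral => //; first exact: measurableT_comp.
  by apply: filterS p0 => x /[apply] px /=; rewrite ger0_norm.
move/(ae_eq_integral_abs mu mS mp) => pS.
by apply: filterS2 ae_unit_sphere pS => x Sx /(_ Sx) [].
Qed.

Hypothesis no_atom : forall x, mu [set x] = 0%E.

(** A function cannot exceed its mean almost everywhere. Hence a point where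
[h] is at most its mean can be found outside of any null set: here the finite
set [F] and the set where some polynomial of [us], of norm [0], does not
vanish. *)
Lemma exists_le_mean h (us : seq (mpoly d R)) (F : seq (d.-tuple R)) :
  {in us, forall u, mean (u * u) = 0} ->
  exists x, [/\ S x, x \notin F, {in us, forall u, peval u x = 0} &
    peval h x <= mean h].
Proof.
move=> us0; apply: contrapT => nox.
have aeF : \forall x \ae mu, x \notin F.
  elim: F {nox} => [|y F ih]; first exact: aeW.
  have : \forall x \ae mu, x <> y.
    exists [set y]; split; [exact: measurable_tuple_set1|exact: no_atom|].
    by move=> z /contrapT.
  apply: filterS2 ih => x xF xy.
  by rewrite inE negb_or xF andbT; exact/eqP.
have aeus : \forall x \ae mu, {in us, forall u, peval u x = 0}.
  elim: us us0 {nox} => [|u us ih] us0; first exact: aeW.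
  have : \forall x \ae mu, peval (u * u) x = 0.
    apply: ae_zero_of_mean0; last by apply: us0; rewrite mem_head.
    by apply: aeW => x _; rewrite /peval mevalM -expr2 sqr_ge0.
  apply: filterS2 (ih _) => [x xus|v vus].
    rewrite /peval mevalM => /eqP; rewrite mulf_eq0 orbb => /eqP ux v.
    by rewrite inE => /orP[/eqP->|/xus].
  by apply: us0; rewrite inE vus orbT.
have aeh : \forall x \ae mu, mean h < peval h x.
  apply: filterS3 ae_unit_sphere aeF aeus => x Sx xF xus.
  by rewrite ltNge; apply/negP => hx; apply: nox; exists x.
pose g := (- mean h) *: 1 + h.
have gE x : peval g x = peval h x - mean h.
  by rewrite /peval mevalD mevalZ meval1 mulr1 addrC.
have aeg : \forall x \ae mu, peval g x = 0.
  apply: ae_zero_of_mean0.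
    by apply: filterS aeh => x hx _; rewrite gE subr_ge0 ltW.
  by rewrite sphere_mean_linear sphere_mean1 mulr1 addNr.
have aeN : \forall x \ae mu, False.
  apply: filterS2 aeh aeg => x + /eqP; rewrite gE subr_eq0 => /[swap] /eqP ->.
  by rewrite ltxx.
have /(measure_negligible measurableT) : mu.-negligible setT.
  by apply: negligibleS aeN => x _ [].
by rewrite [LHS]sphere_measureT => /eqP; rewrite onee_eq0.
Qed.

End polynomials_on_sphere.

(** * Absence of atoms in dimension at least two *)

Section no_atom.
Context {R : realType}.
Local Open Scope classical_set_scope.

Lemma lebesgue_tuple_set1 d (x : d.+1.-tuple R) :
  lebesgue_tuple [set x] = 0%E.
Proof.
rewrite /= /pushforward.
rewrite (_ : _ @^-1` _ = [set thead x] `*` [set [tuple of behead x]]).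
  rewrite product_measure1E//; last exact: measurable_tuple_set1.
  rewrite [X in (X * _)%E](_ : _ = 0%E) ?mul0e//.
 exact: lebesgue_measure_set1.
rewrite {1}(tuple_eta x); apply/seteqP; split=> -[a y] /=.
  by move=> /(congr1 val)/= [-> ey]; split=> //; exact: val_inj.
by move=> [-> ->].
Qed.

Lemma lebesgue_tupleS d (A : set (d.+1.-tuple R)) : lebesgue_tuple A =
  (\int[lebesgue_measure]_a
    (@lebesgue_tuple R d \o xsection (@cons_pair R d @^-1` A)) a)%E.
Proof. by []. Qed.

Lemma radial_projE d (x u : d.-tuple R) i : radial_proj x = u ->
  norm2 x != 0 -> tnth x i = norm2 x * tnth u i.
Proof. by move=> <- x0; rewrite tnth_mktuple mulrCA mulfV// mulr1. Qed.

(** The mass of [u] is the volume of the set [A] of the points of the ball on the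
ray through [u]. A point of this ray is determined by its first coordinate,
unless that coordinate is [0]. So all sections of [A] at a nonzero first
coordinate have at most one point; as they live in a space of positive
dimension they are null, and [A] is null by Tonelli. *)
Lemma sphere_measure_set1 d (u : d.+2.-tuple R) :
  sphere_measure [set u] = 0%E.
Proof.
rewrite /sphere_measure; set A := _ `&` _.
have mA : measurable A.
  apply: measurableI; last exact: measurable_unit_ball.
  rewrite -[X in measurable X]setTI; apply: measurable_radial_proj => //.
  exact: measurable_tuple_set1.
suff -> : lebesgue_tuple A = 0%E by rewrite mule0.
have mcA : measurable (@cons_pair R d.+1 @^-1` A).
  by rewrite -[X in measurable X]setTI; exact: measurable_cons_pair.
have A_inj (x y : d.+2.-tuple R) : A x -> A y ->
    tnth x ord0 != 0 -> tnth x ord0 = tnth y ord0 -> x = y.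
  move=> [xu _] [yu _] x0 xy0.
  have n0 (z : d.+2.-tuple R) : tnth z ord0 != 0 -> norm2 z != 0.
    apply: contraNneq => /eqP; rewrite sqrtr_eq0 => z0.
    rewrite -sqrf_eq0 eq_le sqr_ge0 andbT (le_trans _ z0)// (bigD1 ord0)//=.
    by rewrite lerDl sumr_ge0// => i _; exact: sqr_ge0.
  have nx := n0 _ x0; have ny : norm2 y != 0 by apply: n0; rewrite -xy0.
  have u0 : tnth u ord0 != 0.
    by apply: contraNneq x0 => u0; rewrite (radial_projE _ xu nx) u0 mulr0.
  have nxy : norm2 x = norm2 y.
    apply: (mulIf u0).
    by rewrite -(radial_projE _ xu nx) -(radial_projE _ yu ny).
  apply: eq_from_tnth => i.
  by rewrite (radial_projE _ xu)// (radial_projE _ yu)// nxy.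
rewrite lebesgue_tupleS (@ae_eq_integral _ _ _ _ _ (cst 0%E))//.
- by rewrite integral0.
- exact: measurable_fun_xsection.
exists [set 0 : R]; split => //; first exact: lebesgue_measure_set1.
move=> a /not_implyP[_ nA]; apply: contrapT => /eqP a0; apply: nA.
rewrite [LHS]/comp [RHS]/cst.
have [->|/set0P[x xA]] :=
    eqVneq (xsection (@cons_pair R d.+1 @^-1` A) a) set0.
  exact: measure0.
apply: (@subset_measure0 _ _ _ _ _ [set x]).
- exact: measurable_xsection.
- exact: measurable_tuple_set1.
- move=> y; move: xA; rewrite /xsection/= !inE /preimage/= => xA yA.
  have /(congr1 val)/= [] := A_inj _ _ yA xA a0 erefl.
  exact: val_inj.
- exact: lebesgue_tuple_set1.
Qed.

End no_atom.

(** * Greedy choice of the points *)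

Lemma sum_Cauchy_Schwarz (R : realFieldType) (I : Type) (r : seq I)
    (a b : I -> R) :
  (\sum_(i <- r) a i * b i) ^+ 2 <=
  (\sum_(i <- r) a i ^+ 2) * (\sum_(i <- r) b i ^+ 2).
Proof.
elim: r => [|i r ih]; first by rewrite !big_nil expr0n mul0r.
rewrite !big_cons; set C := \sum_(j <- r) _ in ih *.
set A := \sum_(j <- r) a j ^+ 2 in ih *; set B := \sum_(j <- r) _ in ih *.
have A0 : 0 <= A by apply: sumr_ge0 => j _; exact: sqr_ge0.
have B0 : 0 <= B by apply: sumr_ge0 => j _; exact: sqr_ge0.
clearbody A B C.
(* Arithmetic-geometric mean, as [C^2 <= A B]. *)
have cross : 2 * (a i * b i * C) <= a i ^+ 2 * B + b i ^+ 2 * A.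
  have t0 : 0 <= a i ^+ 2 * B + b i ^+ 2 * A.
    by rewrite addr_ge0// mulr_ge0// sqr_ge0.
  apply: le_trans (ler_norm _) _.
  rewrite -ler_sqr ?nnegrE// real_normK ?num_real//.
  apply: (@le_trans _ _ (4 * (a i * b i) ^+ 2 * (A * B))).
    rewrite [leLHS](_ : _ = 4 * (a i * b i) ^+ 2 * C ^+ 2); last by ring.
    by rewrite ler_wpM2l// mulr_ge0// sqr_ge0.
  rewrite -subr_ge0 [leRHS](_ : _ = (a i ^+ 2 * B - b i ^+ 2 * A) ^+ 2).
    exact: sqr_ge0.
  by ring.
rewrite -subr_ge0 [leRHS](_ : _ = (A * B - C ^+ 2) +
    (a i ^+ 2 * B + b i ^+ 2 * A - 2 * (a i * b i * C))); last by ring.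
by rewrite addr_ge0 ?subr_ge0.
Qed.

Section greedy.
Context {R : realType} {d : nat}.
Local Open Scope classical_set_scope.
Local Notation mu := (@sphere_measure R d).
Local Notation S := (@unit_sphere R d).
Local Notation mean p := (sphere_mean (peval p)).
Implicit Types p q h u : mpoly d R.

Let meanD p q : mean (p + q) = mean p + mean q.
Proof. by rewrite -[p]scale1r sphere_mean_linear mul1r scale1r. Qed.

Let mean0 : mean (0 : mpoly d R) = 0.
Proof. by apply: (addrI (mean (0 : mpoly d R))); rewrite -meanD !addr0. Qed.

Hypothesis d_gt0 : (0 < d)%N.

Let mean_sqr_shift c p :
  mean ((c *: 1 + p) * (c *: 1 + p)) =
    (c + mean p) ^+ 2 + mean (p * p) - mean p ^+ 2.
Proof.
rewrite (_ : _ * _ = (c * c) *: 1 + ((c + c) *: p + p * p)); last first.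
  rewrite mulrDl !mulrDr -!scalerAl -!scalerAr !mul1r !mulr1 scalerA scalerDl.
  by rewrite !addrA.
by rewrite !sphere_mean_linear sphere_mean1//; ring.
Qed.

Hypothesis no_atom : forall x, mu [set x] = 0%E.

(** The sum over [gs] plays the role of the variance of the sample, and grows
linearly in the number [n] of points as it would for independent points. *)
Lemma exists_balanced_points (gs us : seq (mpoly d R)) n :
  {in gs, forall g, mean (g * g) <= 1} -> {in us, forall u, mean (u * u) = 0} ->
  exists xs : seq (d.-tuple R), [/\ uniq xs, size xs = n,
    {in xs, forall x, S x},
    {in xs, forall x, {in us, forall u, peval u x = 0}} &
    \sum_(g <- gs) (\sum_(x <- xs) (peval g x - mean g)) ^+ 2
      <= n%:R * (size gs)%:R].
Proof.
move=> gs1 us0; elim: n => [|n [xs [uxs sxs Sxs xus Hxs]]].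
  exists [::]; split=> //; rewrite mul0r big1// => g _.
  by rewrite big_nil expr0n.
(* Adding [x] to the points turns the sum into [h x], and the mean of
[(c g + (g - mean g))^2] is [c g ^ 2] plus the variance of [g]. *)
pose c g := \sum_(x <- xs) (peval g x - mean g).
pose q g : mpoly d R := (c g - mean g) *: 1 + g.
pose h := \sum_(g <- gs) q g * q g.
have [x [Sx xF xu hx]] := exists_le_mean d_gt0 no_atom h xs us0.
exists (x :: xs); split=> //=.
- by rewrite xF.
- by rewrite sxs.
- by move=> y /[!inE]/orP[/eqP->|/Sxs].
- by move=> y /[!inE]/orP[/eqP->|/xus].
have -> : \sum_(g <- gs) (\sum_(y <- x :: xs) (peval g y - mean g)) ^+ 2
    = peval h x.
  rewrite /peval /h (raddf_sum (meval (tnth x))); apply: eq_bigr => g _.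
  rewrite big_cons /= mevalM mevalD mevalZ meval1 -/(c g) -expr2.
  by congr (_ ^+ 2); rewrite /peval; ring.
apply: le_trans hx _.
have -> : mean h = \sum_(g <- gs) mean (q g * q g).
  by apply: (big_morph (fun p => mean p)); [exact: meanD|exact: mean0].
rewrite -natr1 mulrDl mul1r.
apply: (@le_trans _ _ (\sum_(g <- gs) (c g ^+ 2 + 1))).
  rewrite big_seq [leRHS]big_seq; apply: ler_sum => g /gs1 g1.
  rewrite mean_sqr_shift subrK -addrA lerD2l.
  by rewrite lerBlDr (le_trans g1)// lerDl sqr_ge0.
rewrite big_split/= lerD//.
by rewrite big_const_seq count_predT -Monoid.iteropE.
Qed.

(** With [gs] a frame for the polynomials of degree at most [s], the total error
on [p] over the points is [sum_g <p, g> D g], where [D g] is the total error on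
[g]. By Cauchy-Schwarz and Parseval its square is at most [<p, p>] times the sum
of the [D g ^ 2], which is at most [n * size gs]. *)
Lemma exists_design_of_size s n eps : (0 < n)%N -> 0 <= eps ->
  (d.+1 ^ s)%:R <= eps ^+ 2 * n%:R ->
  exists2 X : {fset d.-tuple R}, approx_design s eps X & #|` X| = n.
Proof.
move=> n0 eps0 Nn.
pose B p q := mean (p * q).
have Blin a u v w : B (a *: u + v) w = a * B u w + B v w.
  by rewrite /B mulrDl -scalerAl sphere_mean_linear.
have Bsym u v : B u v = B v u by rewrite /B mulrC.
have Bge0 u : 0 <= B u u by exact: sphere_mean_sqr_ge0.
pose fs := [seq mpolyX R (bmnm m) | m <- enum {: bmultinom d s.+1}].
have [gs [sgs gs1 fsr]] := exists_parseval_frame Blin Bsym Bge0 fs.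
have us0 : {in [seq residual B gs f | f <- fs], forall u, mean (u * u) = 0}.
  by move=> _ /mapP[f ffs ->]; exact: fsr.
have [xs [uxs sxs Sxs xus Hxs]] := exists_balanced_points n gs1 us0.
have fsX (m : bmultinom d s.+1) : mpolyX R m \in fs.
  by apply/mapP; exists m => //; rewrite mem_enum.
have cardX : #|` [fset x in xs]| = n.
  by rewrite card_fseq undup_id.
exists [fset x in xs] => //; split.
- by rewrite -cardfs_gt0 cardX.
- by move=> x; rewrite inE => /Sxs.
move=> p ps; rewrite cardX.
have resE : residual B gs p =
    \sum_(m : bmultinom d s.+1) mcoeff m p *: residual B gs (mpolyX R m).
  by rewrite {1}(deg_leE ps); exact: residual_sum.
have res_rad : form_radical B (residual B gs p).
  by rewrite resE; apply: form_radical_sum => // m; apply: fsr; exact: fsX.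
(* The mean of [p] is [<p, 1>], so that the residual does not contribute. *)
have meanE : mean p = \sum_(g <- gs) B p g * mean g.
  have : B (residual B gs p) 1 = 0 by exact: res_rad.
  rewrite /B mulr1 /residual -scaleN1r addrC sphere_mean_linear mulN1r addrC.
  move=> /eqP; rewrite subr_eq0 => /eqP ->.
  elim/big_rec2: _ => [|g u v _ <-]; first exact: mean0.
  exact: sphere_mean_linear.
have pevalE x : x \in xs -> peval p x = \sum_(g <- gs) B p g * peval g x.
  move=> xxs; have : peval (residual B gs p) x = 0.
    rewrite resE /peval (raddf_sum (meval (tnth x))) big1// => m _.
    rewrite /= mevalZ [X in _ * X](xus _ xxs) ?mulr0//.
    by apply: map_f; exact: fsX.
  rewrite /peval mevalB (raddf_sum (meval (tnth x))) => /eqP.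
  rewrite subr_eq0 => /eqP ->; apply: eq_bigr => g _.
  by rewrite /= mevalZ.
set D := fun g => \sum_(x <- xs) (peval g x - mean g) in Hxs.
have errE : \sum_(g <- gs) B p g * D g =
    \sum_(x <- xs) peval p x - mean p *+ n.
  under eq_bigr do rewrite /D mulr_sumr.
  rewrite exchange_big/= -sxs -[X in _ *+ X]count_predT.
  rewrite -[X in _ - X]iter_addr_0 -big_const_seq -sumrB.
  rewrite big_seq [RHS]big_seq; apply: eq_bigr => x xxs.
  rewrite (pevalE x xxs) meanE -sumrB.
  by apply: eq_bigr => g _; rewrite mulrBr.
have -> : \sum_(x <- [fset x in xs]) peval p x = \sum_(x <- xs) peval p x.
  by apply: perm_big; apply: uniq_perm => // x; rewrite inE.
have n0R : 0 < n%:R :> R by rewrite ltr0n.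
rewrite -[mean p](mulfK (lt0r_neq0 n0R)) mulr_natr -mulrBl -errE normrM.
rewrite [X in _ * X]gtr0_norm ?invr_gt0// ler_pdivrMr// sphere_norm2E.
rewrite -ler_sqr ?nnegrE ?mulr_ge0 ?sqrtr_ge0 ?ler0n// real_normK ?num_real//.
apply: le_trans (sum_Cauchy_Schwarz _ _ _) _.
rewrite (parseval Blin Bsym res_rad) !exprMn sqr_sqrtr; last exact: Bge0.
rewrite -[leRHS]mulrA [leRHS]mulrCA.
apply: ler_wpM2l; first exact: Bge0.
apply: le_trans Hxs _.
rewrite mulrC expr2 mulrA ler_wpM2r ?ler0n//; apply: le_trans Nn.
rewrite ler_nat (leq_trans sgs)// size_map -cardE.
exact: card_bmultinom_le.
Qed.

End greedy.

(** * Dimension one *)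

Section dimension_one.
Context {R : realType}.
Local Open Scope classical_set_scope.

Lemma norm2_1 (x : 1.-tuple R) : norm2 x = `|thead x|.
Proof. by rewrite /norm2 big_ord1 sqrtr_sqr. Qed.

Lemma unit_sphere1 : @unit_sphere R 1 = [set [tuple 1]] `|` [set [tuple -1]].
Proof.
apply/seteqP; split=> x; rewrite /unit_sphere/= norm2_1; last first.
  by move=> [->|->]; rewrite theadE ?normrN normr1.
case/tupleP: x => a x; rewrite theadE (tuple0 x) => a1.
have [a0|/ltW a0] := leP 0 a; [left|right].
  by apply: eq_from_tnth => i; rewrite -[in RHS]a1 ger0_norm// !ord1.
by apply: eq_from_tnth => i; rewrite -[in RHS]a1 ler0_norm// opprK !ord1.
Qed.

Lemma cube1 (I : set R) : cube 1 I = [set x | I (thead x)].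
Proof.
by apply/seteqP; split=> [x Ix|x Ix i]; [exact: Ix|rewrite (ord1 i)].
Qed.

Lemma lebesgue_unit_ball1 : lebesgue_tuple (@unit_ball R 1) = 2%:E.
Proof.
rewrite (_ : @unit_ball R 1 = cube 1 `[-1, 1]).
  rewrite lebesgue_tuple_cube// lebesgue_measure_itv/= lte_fin gtrN//.
  by rewrite -EFinB opprK.
by rewrite cube1; apply/seteqP; split=> x;
  rewrite /unit_ball/= norm2_1 in_itv/= -ler_norml.
Qed.

Lemma sphere_measure_pos1 : sphere_measure [set [tuple 1 : R]] = (2^-1)%:E.
Proof.
rewrite /sphere_measure lebesgue_unit_ball1 [fine _]/=.
rewrite (_ : _ `&` _ = cube 1 `]0, 1]).
  rewrite lebesgue_tuple_cube// lebesgue_measure_itv/= lte_fin ltr01.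
  by rewrite -EFinB subr0 mule1.
rewrite cube1; apply/seteqP; split=> x; rewrite /unit_ball/= norm2_1 in_itv/=.
  move=> [/(congr1 (@thead _ _))]; rewrite theadE [thead _]tnth_mktuple norm2_1.
  rewrite -/(thead x) => x1 xle1; rewrite (le_trans (ler_norm _) xle1) andbT.
  have [x0|x0|x0] := ltgtP 0 (thead x) => //.
  - move: x1; rewrite ltr0_norm// invrN mulrN mulfV ?lt_eqF// => /eqP.
    by rewrite eq_sym -subr_eq0 opprK -mulr2n pnatr_eq0.
  - by move: x1; rewrite -x0 mul0r => /eqP; rewrite eq_sym oner_eq0.
move=> /andP[x0 x1]; split; last by rewrite gtr0_norm.
apply: eq_from_tnth => i; rewrite tnth_mktuple norm2_1 !ord1 -/(thead x).
by rewrite gtr0_norm// mulfV// gt_eqF.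
Qed.

Lemma pos1_neq_neg1 : [tuple 1 : R] <> [tuple -1].
Proof.
move=> /(congr1 (@thead _ _)); rewrite !theadE => /eqP.
by rewrite -subr_eq0 opprK -mulr2n pnatr_eq0.
Qed.

Lemma sphere_measure_neg1 : sphere_measure [set [tuple -1 : R]] = (2^-1)%:E.
Proof.
have := sphere_measure_sphere (R := R) (isT : (0 < 1)%N).
rewrite unit_sphere1 measureU; [|exact: measurable_tuple_set1..|].
  rewrite [X in (X + _)%E]sphere_measure_pos1.
  have m1 : sphere_measure [set [tuple -1 : R]] \is a fin_num.
    apply: (fin_num_measure (@sphere_measure R 1)).
    exact: measurable_tuple_set1.
  rewrite -(fineK m1) -[X in (_ + X)%E](fineK m1) => -[m1E].
  by congr EFin; lra.
by rewrite -subset0 => x [-> /pos1_neq_neg1].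
Qed.

Lemma sphere_mean1E (p : mpoly 1 R) :
  sphere_mean (peval p) = (peval p [tuple 1] + peval p [tuple -1]) / 2.
Proof.
have mean_set1 (x : 1.-tuple R) :
    \int[@sphere_measure R 1]_(y in [set x]) peval p y =
    peval p x * fine (sphere_measure [set x]).
  rewrite -Rintegral_cst; last exact: measurable_tuple_set1.
  by apply: eq_Rintegral => y; rewrite inE => ->.
rewrite /sphere_mean unit_sphere1 Rintegral_setU.
- by rewrite !mean_set1 sphere_measure_pos1 sphere_measure_neg1/= mulrDl.
- exact: measurable_tuple_set1.
- exact: measurable_tuple_set1.
- by rewrite -unit_sphere1; exact: integrable_peval.
- by apply/disj_set2P; rewrite -subset0 => x [-> /pos1_neq_neg1].
Qed.

Lemma exists_design1_pair s (eps : R) : 0 <= eps ->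
  exists2 X : {fset 1.-tuple R}, approx_design s eps X & #|` X| = 2%N.
Proof.
move=> eps0; exists [fset [tuple 1 : R]; [tuple -1]]%fset; last first.
  by rewrite cardfs2; case: eqP => // /pos1_neq_neg1.
have card2 : #|` [fset [tuple 1 : R]; [tuple -1]]%fset| = 2%N.
  by rewrite cardfs2; case: eqP => // /pos1_neq_neg1.
split; first by rewrite -cardfs_gt0 card2.
  by move=> x; rewrite !inE unit_sphere1 => /orP[]/eqP ->; [left|right].
move=> p _; rewrite card2 sphere_mean1E big_fsetU1/=; last first.
  by rewrite inE; apply/eqP; exact: pos1_neq_neg1.
by rewrite big_seq_fset1 subrr normr0 mulr_ge0// sqrtr_ge0.
Qed.

(** The error at [1] is [(a - b) / 2], where [a] and [b] are the values of [p] at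
[1] and [-1], and the squared norm [(a^2 + b^2) / 2] exceeds its square by
[((a + b) / 2)^2]. *)
Lemma exists_design1_single s (eps : R) : 1 <= eps ->
  exists2 X : {fset 1.-tuple R}, approx_design s eps X & #|` X| = 1%N.
Proof.
move=> eps1; exists [fset [tuple 1 : R]]%fset; last exact: cardfs1.
split; first by rewrite -cardfs_gt0 cardfs1.
  by move=> x; rewrite inE unit_sphere1 => /eqP ->; left.
move=> p _; rewrite cardfs1 divr1 big_seq_fset1 sphere_norm2E !sphere_mean1E.
apply: (@le_trans _ _ (1 * Num.sqrt
    ((peval (p * p) [tuple 1] + peval (p * p) [tuple -1]) / 2))); last first.
  by rewrite ler_wpM2r// sqrtr_ge0.
rewrite mul1r -sqrtr_sqr ler_wsqrtr// /peval !mevalM.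
set a := meval _ p; set b := meval _ p; clearbody a b.
rewrite -subr_ge0 [leRHS](_ : _ = ((a + b) / 2) ^+ 2); first exact: sqr_ge0.
by field.
Qed.

End dimension_one.

(** * The theorem *)

Theorem proposition6p8 (R : realType) (t : nat) :
  exists2 C : R, 0 < C &
    forall (d : nat) (eps : R), (0 < d)%N -> 0 < eps ->
      exists2 X : {fset d.-tuple R},
        approx_design (2 * t) eps X &
        #|` X|%:R <= Num.max 1 (C * eps ^- 2 * d%:R ^+ (2 * t)).
Proof.
exists (2 ^+ (2 * t).+1); first by rewrite exprn_gt0.
move=> d eps d0 eps0; set A := _ * _ * _.
have [d1|d1] := eqVneq d 1%N.
  subst d; have [eps1|eps1] := leP 1 eps.
    have [X dX cX] := exists_design1_single (2 * t) eps1.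
    by exists X => //; rewrite cX le_max lexx.
  have [X dX cX] := exists_design1_pair (2 * t) (ltW eps0).
  exists X => //; rewrite cX le_max /A expr1n mulr1; apply/orP; right.
  rewrite -[leLHS]mulr1 ler_pM//.
    by rewrite -[leLHS]expr1 ler_weXn2l// ler1n.
  by rewrite invf_ge1 ?exprn_gt0// exprn_ile1// ltW.
have no_atom (x : d.-tuple R) : sphere_measure [set x]%classic = 0%E.
  by case: d d0 d1 x {A} => [//|[//|d]] _ _ x; exact: sphere_measure_set1.
have A0 : 0 <= A by rewrite !mulr_ge0 ?invr_ge0 ?exprn_ge0// ltW.
(* The extra factor [2] in the constant pays for rounding [A] down to an
integer. *)
have NA : (d.+1 ^ (2 * t))%:R * 2 <= eps ^+ 2 * A.
  have -> : eps ^+ 2 * A = 2 ^+ (2 * t).+1 * d%:R ^+ (2 * t).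
    by rewrite /A -mulrA mulrCA mulVKf// expf_neq0// gt_eqF.
  rewrite exprS -mulrA -exprMn mulrC ler_wpM2l// natrX lerXn2r ?nnegrE//.
  by rewrite -natrM ler_nat mul2n -addnn -addn1 leq_add2l.
clearbody A.
have [n [n0 nA An]] : exists n, [/\ (0 < n)%N, n%:R <= Num.max 1 A &
    A <= n%:R * 2].
  have [A1|A1] := ltP A 1.
    exists 1%N; split; rewrite ?le_max ?lexx//.
    by rewrite mul1r (le_trans (ltW A1))// ler1n.
  exists (Num.truncn A); split; first by rewrite truncn_gt0.
    by rewrite truncn_le.
  apply: le_trans (ltW (truncnS_gt A)) _.
  by rewrite -natrM ler_nat muln2 -addnn -addn1 leq_add2l truncn_gt0.
have [|X dX cX] :=
    @exists_design_of_size R d d0 no_atom (2 * t) n eps n0 (ltW eps0).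
  rewrite -(ler_pM2r (ltr0n R 2)) (le_trans NA)// -[leRHS]mulrA ler_wpM2l//.
  exact: sqr_ge0.
by exists X => //; rewrite cX.
Qed.
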